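(* Let $X$ be a reflexive real Banach space and $A:X\rightrightarrows X^*$ a maximal monotone operator such that $\operatorname{int}(D(A))\neq\emptyset$. Let $D$ be a dense subset of $D(A)$ and let $\tilde A$ be a selection of $A$. Then for every $x\in D(A)$ and every $v\in\operatorname{int}(D(A)-x)$, the set $$w\text{-}\operatorname{Limsup}_{\substack{w\to v,\ t\downarrow0\\ x+tw\in D}}\tilde A(x+tw)$$ is a nonempty subset of $A(x;v)$.
   Context: $X^*$ is the continuous dual of $X$, $\langle\cdot,\cdot\rangle$ the duality pairing, $\to$ norm convergence and $\rightharpoonup$ weak convergence; interior and density refer to the norm topology. For a set-valued operator $A:X\rightrightarrows X^*$, $D(A)=\{x\in X: Ax\neq\emptyset\}$. $A$ is monotone if $\langle x^*-y^*,x-y\rangle\ge 0$ whenever $x^*\in Ax$, $y^*\in Ay$, and maximal monotone if in addition its graph is not properly contained in the graph of another monotone operator. A selection of $A$ is a single-valued map $\tilde A:D(A)\to X^*$ with $\tilde A(y)\in Ay$ for all $y\in D(A)$. ''$D$ is a dense subset of $D(A)$'' means $D\subset D(A)\subset\overline{D}$. For $x\in D(A)$ and $v\in X$, $A(x;v):=\{x^*\in Ax:\langle x^*,v\rangle=\sigma_{Ax}(v)\}$, where $\sigma_{Ax}(v)=\sup\{\langle x^*,v\rangle:x^*\in Ax\}$. $w\text{-}\operatorname{Limsup}_{w\to v,\,t\downarrow0,\,x+tw\in D}\tilde A(x+tw)$ is the set of all $x^*\in X^*$ for which there exist sequences $w_n\to v$ in $X$ and $t_n\downarrow0$ (with $t_n>0$)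 such that $x+t_nw_n\in D$ for all $n\in\mathbb{N}$ and $\tilde A(x+t_nw_n)\rightharpoonup x^*$. *)

(* Defs.v *)
From HB Require Import structures.
From mathcomp Require Import all_boot all_order all_algebra.
From mathcomp Require Import all_classical all_reals all_analysis.

Set Implicit Arguments.
Unset Strict Implicit.
Unset Printing Implicit Defensive.

Import Order.TTheory GRing.Theory Num.Theory.
Import numFieldNormedType.Exports.

Local Open Scope classical_set_scope.
Local Open Scope ring_scope.

Section Dual.
Context {R : realType} (X : normedModType R).

Definition is_dual : {pred X -> R^o} :=
  fun f => `[< linear f /\ continuous f >].

Record dual := Dual { dual_val :> X -> R^o ; dual_valP : dual_val \in is_dual }.

HB.instance Definition _ := [isSub for dual_val].
HB.instance Definition _ := [Choice of dual by <:].

Lemma is_dual_submod_closed : submod_closed is_dual.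
Proof.
split=> [|a f g /asboolP[lf cf] /asboolP[lg cg]]; apply/asboolP; split.
- by move=> a x y; rewrite -[RHS]/(a *: (0 : R^o) + 0) scaler0 addr0.
- exact: (@cst_continuous _ R^o 0).
- move=> b x y; rewrite -[LHS]/(a *: f (b *: x + y) + g (b *: x + y)) lf lg.
  rewrite -[RHS]/(b *: (a *: f x + g x) + (a *: f y + g y)).
  by rewrite !scalerDr !scalerA (mulrC a b) addrACA.
- move=> x; apply: (@continuousD _ R^o); last exact: cg.
  by apply: continuousZr; exact: cf.
Qed.

HB.instance Definition _ :=
  GRing.isSubmodClosed.Build R (X -> R^o) is_dual is_dual_submod_closed.
HB.instance Definition _ := [SubChoice_isSubLmodule of dual by <:].

Lemma dual_linear (f : dual) : linear f.
Proof. by have /asboolP[] := dual_valP f. Qed.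

HB.instance Definition _ (f : dual) :=
  GRing.isLinear.Build R X R^o _ (dual_val f) (dual_linear f).

Lemma dual_continuous (f : dual) : continuous f.
Proof. by have /asboolP[] := dual_valP f. Qed.

Definition dual_norm (f : dual) : R :=
  sup [set `|f x| | x in [set x | `|x| <= 1]].

Lemma dual_bound (f : dual) : exists M, forall x, `|f x| <= M * `|x|.
Proof.
have /linear_bounded_continuous/linear_boundedP := @dual_continuous f.
by move=> /pinfty_ex_gt0[M _ fM]; exists M.
Qed.

Lemma dual_norm_has_sup (f : dual) :
  has_sup [set `|f x| | x in [set x | `|x| <= 1]].
Proof.
split; first by exists `|f 0|, 0 => //=; rewrite normr0.
have [M fM] := dual_bound f; exists `|M| => _ [x /= x1 <-].
rewrite (le_trans (fM x))// (le_trans (ler_norm _))// normrM normr_id.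
by rewrite ler_piMr.
Qed.

Lemma ler_dual_norm1 (f : dual) x : `|x| <= 1 -> `|f x| <= dual_norm f.
Proof.
by move=> x1; apply: ub_le_sup; [exact: (dual_norm_has_sup f).2|exists x].
Qed.

Lemma dual_norm_le (f : dual) (M : R) :
  (forall x, `|x| <= 1 -> `|f x| <= M) -> dual_norm f <= M.
Proof.
move=> fM; apply: ge_sup; first exact: (dual_norm_has_sup f).1.
by move=> _ [x /= x1 <-]; exact: fM.
Qed.

Lemma ler_dual_norm (f : dual) x : `|f x| <= dual_norm f * `|x|.
Proof.
have [->|x0] := eqVneq x 0; first by rewrite linear0 !normr0 mulr0.
have nx0 : 0 < `|x| by rewrite normr_gt0.
rewrite -ler_pdivrMr//.
have := @ler_dual_norm1 f (`|x|^-1 *: x).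
rewrite normrZ normfV normr_id mulVf ?gt_eqF// => /(_ (lexx _)).
by rewrite linearZ normrZ normfV normr_id mulrC.
Qed.

Lemma ler_dual_normD (f g : dual) :
  dual_norm (f + g) <= dual_norm f + dual_norm g.
Proof.
apply: dual_norm_le => x x1; rewrite (le_trans (ler_normD (f x) (g x)))//.
by rewrite lerD// ler_dual_norm1.
Qed.

Lemma dual_norm_ge0 (f : dual) : 0 <= dual_norm f.
Proof.
by apply: le_trans (@ler_dual_norm1 f 0 _); rewrite ?normr0.
Qed.

Lemma dual_normZ (a : R) (f : dual) : dual_norm (a *: f) = `|a| * dual_norm f.
Proof.
have le_normZ b (g : dual) : dual_norm (b *: g) <= `|b| * dual_norm g.
  apply: dual_norm_le => x x1.
  rewrite -[X in `|X|]/(b *: g x) normrZ.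
  by rewrite ler_wpM2l// ler_dual_norm1.
apply/eqP; rewrite eq_le le_normZ /=.
have [->|a0] := eqVneq a 0; first by rewrite normr0 mul0r dual_norm_ge0.
rewrite -ler_pdivlMl ?normr_gt0// -normfV.
by rewrite (le_trans _ (le_normZ _ _))// scalerA mulVf// scale1r.
Qed.

Lemma dual_norm0_eq0 (f : dual) : dual_norm f = 0 -> f = 0.
Proof.
move=> f0; apply/val_inj/funext => x; apply/eqP.
by rewrite -normr_le0 (le_trans (ler_dual_norm f x))// f0 mul0r.
Qed.

HB.instance Definition _ := @Lmodule_isNormed.Build R dual dual_norm
  ler_dual_normD dual_normZ dual_norm0_eq0.

End Dual.

Section Reflexive.
Context {R : realType} (X : normedModType R).

Lemma bidual_subproof (x : X) :
  (fun f : dual X => f x : R^o) \in @is_dual R (dual X).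
Proof.
have l : linear (fun f : dual X => f x : R^o) by [].
apply/asboolP; split=> //.
pose e : {linear dual X -> R^o} := HB.pack (fun f : dual X => f x : R^o)
  (GRing.isLinear.Build _ _ _ _ _ l).
apply: (@bounded_linear_continuous _ _ _ e); apply/bounded_funP => r.
exists (r * `|x|) => f fr; rewrite (le_trans (ler_dual_norm f x))//.
by rewrite ler_wpM2r.
Qed.

Definition bidual (x : X) : dual (dual X) := Dual (bidual_subproof x).

Definition reflexive_space :=
  forall phi : dual (dual X), exists x, bidual x = phi.

Definition weakly_cvg (u : nat -> X) (l : X) :=
  forall f : dual X, (f (u n) : R) @[n --> \oo] --> (f l : R).

End Reflexive.

Section MonotoneOperators.
Context {R : realType} (X : normedModType R).
Implicit Types A : X -> set (dual X).

Definition domain A : set X := [set x | A x !=set0].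

Definition graph A : set (X * dual X) := [set p | A p.1 p.2].

Definition monotone_operator A := forall (x y : X) (xs ys : dual X),
  A x xs -> A y ys -> 0 <= ((xs - ys) (x - y) : R).

Definition maximal_monotone A :=
  monotone_operator A /\ ~ exists B, monotone_operator B /\ graph A `<` graph B.

(* A selection is a map on domain A; its values elsewhere are irrelevant. *)
Definition selection A (At : X -> dual X) := forall y, domain A y -> A y (At y).

Definition dense_in (D E : set X) := D `<=` E /\ E `<=` closure D.

Definition support_function (C : set (dual X)) (v : X) : \bar R :=
  ereal_sup [set (xs v)%:E | xs in C].

Definition face A (x v : X) : set (dual X) :=
  [set xs | A x xs /\ (xs v)%:E = support_function (A x) v].

(* Weak convergence in X^* is tested against all of X^** (weakly_cvg at dual X,
   whose topology is that of dual_norm). t_n decreasing to 0 is read as t_n > 0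
   and t_n --> 0; requiring monotonicity would give the same set, by passing to
   a subsequence. *)
Definition wLimsup (D : set X) (At : X -> dual X) (x v : X) : set (dual X) :=
  [set xs | exists (w : nat -> X) (t : nat -> R),
    [/\ w n @[n --> \oo] --> v,
        (forall n, 0 < t n) /\ t n @[n --> \oo] --> 0,
        forall n, D (x + t n *: w n) &
        weakly_cvg (fun n => At (x + t n *: w n)) xs] ].

End MonotoneOperators.

(* Main.v *)
(* Local boundedness of A at x + v (Baire) together with monotonicity along the
   direction v bounds A (x + t w) uniformly for w near v and 0 < t <= 1. The same
   local bound shows that x + t v lies in the domain of A: a functional in
   A (x + t v) is a solution of a system of linear inequalities indexed by the
   graph, and the Mazur-Orlicz theorem reduces its solvability to an estimate on
   convex combinations of graph points. Density then provides points of D in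
   every direction close to v, and bounded sequences in the dual of a reflexive
   space have weakly convergent subsequences. Passing to the limit in the
   monotonicity inequality, maximality puts every weak limit in A x, and
   monotonicity between x and x + t w makes it maximal in the direction v. *)
Require Import Defs.
From HB Require Import structures.
From mathcomp Require Import all_boot all_order all_algebra.
From mathcomp Require Import all_classical all_reals all_analysis.
From mathcomp Require Import ring lra.

Set Implicit Arguments.
Unset Strict Implicit.
Unset Printing Implicit Defensive.

Import Order.TTheory GRing.Theory Num.Theory.
Import numFieldNormedType.Exports.

Local Open Scope classical_set_scope.
Local Open Scope ring_scope.

(** * Hahn-Banach through minimal sublinear functionals *)

Section HahnBanach.
Context {R : realType} (V : lmodType R).
Implicit Types (p q : V -> R).

(** Homogeneity is asked only as an inequality, the form that survives infima; [sublinearZ] recovers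
    equality by means of the inverse scalar. *)
Definition sublinear p :=
  (forall x y, p (x + y) <= p x + p y) /\
  (forall (s : R) x, 0 <= s -> p (s *: x) <= s * p x).

Lemma sublinear0 p : sublinear p -> p 0 = 0.
Proof.
move=> [pD pZ]; apply/eqP; rewrite eq_le; apply/andP; split.
  by have := pZ 0 0 (lexx _); rewrite scale0r mul0r.
by have := pD 0 0; rewrite addr0; lra.
Qed.

Lemma sublinear_geN p x : sublinear p -> - p (- x) <= p x.
Proof.
move=> sp; have := sp.1 x (- x); rewrite subrr (sublinear0 sp); lra.
Qed.

Lemma sublinearZ p (s : R) x : sublinear p -> 0 <= s -> p (s *: x) = s * p x.
Proof.
move=> sp; rewrite le_eqVlt => /predU1P[<-|s0].
  by rewrite scale0r mul0r sublinear0.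
apply/eqP; rewrite eq_le (sp.2 _ _ (ltW s0))/=.
have := sp.2 s^-1 (s *: x); rewrite scalerA mulVf ?gt_eqF// scale1r.
by rewrite invr_ge0 => /(_ (ltW s0)); rewrite ler_pdivlMl.
Qed.

(** The infima over [i] and [j] are taken one after the other, so closure of the family up to
    domination is enough. This serves lower bounds of chains, the minimality argument and the
    Mazur-Orlicz majorant. *)
Lemma sublinear_inf (I : Type) (S : set I) (g : I -> V -> R) :
  S !=set0 ->
  (forall x, has_lbound [set g i x | i in S]) ->
  (forall i j x y, S i -> S j ->
    exists2 k, S k & g k (x + y) <= g i x + g j y) ->
  (forall i s x, S i -> 0 <= s -> exists2 k, S k & g k (s *: x) <= s * g i x) ->
  sublinear (fun x => inf [set g i x | i in S]).
Proof.
move=> [i0 Si0] lbg gD gZ.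
have ne x : [set g i x | i in S] !=set0 by exists (g i0 x), i0.
split=> [x y|s x s0].
- rewrite -lerBlDr; apply: lb_le_inf => // _ [i Si <-].
  rewrite lerBlDr -lerBlDl; apply: lb_le_inf => // _ [j Sj <-].
  rewrite lerBlDl; have [k Sk] := gD i j x y Si Sj; apply: le_trans.
  by apply: ge_inf => //; exists k.
- have := s0; rewrite le_eqVlt => /predU1P[<-|s1].
    have [k Sk] := gZ _ 0 x Si0 (lexx _); rewrite !mul0r; apply: le_trans.
    by apply: ge_inf => //; exists k.
  rewrite -ler_pdivrMl//; apply: lb_le_inf => // _ [i Si <-].
  rewrite ler_pdivrMl//; have [k Sk] := gZ i s x Si s0; apply: le_trans.
  by apply: ge_inf => //; exists k.
Qed.

Lemma minimal_sublinear p : sublinear p ->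
  exists q, [/\ sublinear q, forall x, q x <= p x &
    forall r, sublinear r -> (forall x, r x <= q x) -> r = q].
Proof.
move=> sp.
pose T := {q : V -> R | sublinear q /\ forall x, q x <= p x}.
(* The order is reversed, so that a Zorn-maximal element is a minimal sublinear functional. *)
pose Rel (q r : T) := `[< forall x, sval r x <= sval q x >].
have [| | | |q qmin] := @Zorn T Rel.
- by move=> t; apply/asboolP.
- move=> r s t /asboolP rs /asboolP st; apply/asboolP => x.
  exact: le_trans (st x) (rs x).
- move=> [s Ps] [t Pt] /asboolP/= st /asboolP/= ts.
  apply: eq_exist; apply/funext => x; apply/eqP.
  by rewrite eq_le st ts.
- move=> C Ctot; have [C0|/set0P C0] := eqVneq C set0.
    by exists (exist _ p (conj sp (fun x => lexx _))) => s; rewrite C0.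
  (* A sublinear [q] below [p] satisfies [- p (- x) <= - q (- x) <= q x]. *)
  have lbC x : has_lbound [set sval i x | i in C].
    exists (- p (- x)) => _ [[q [sq qp]] Cq <-] /=.
    by apply: le_trans (sublinear_geN _ sq); rewrite lerN2.
  have infC (r : T) x : C r -> inf [set sval i x | i in C] <= sval r x.
    by move=> Cr; apply: ge_inf => //; exists r.
  have Psup : sublinear (fun x => inf [set sval i x | i in C]) /\
      forall x, inf [set sval i x | i in C] <= p x.
    split; last first.
      by case: C0 => r Cr x; apply: le_trans (infC r x Cr) _; case: r {Cr} => ? [].
    apply: sublinear_inf => //.
      move=> i j x y Ci Cj; have [/asboolP|/asboolP] := Ctot i j Ci Cj => ij.
        exists j => //; case: j ij {Cj} => /= j [sj _] ij.
        by apply: le_trans (sj.1 _ _) _; rewrite lerD2r.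
      exists i => //; case: i ij {Ci} => /= k [sk _] ij.
      by apply: le_trans (sk.1 _ _) _; rewrite lerD2l.
    move=> i s x Ci s0; exists i => //; case: i {Ci} => /= k [sk _] /=.
    exact: sk.2.
  exists (exist (fun q => sublinear q /\ forall x, q x <= p x) _ Psup) => s Cs; apply/asboolP => x /=; exact: infC.
exists (sval q); case: q qmin => q [sq qp] /= qmin; split=> // r sr rq.
have Pr : sublinear r /\ forall x, r x <= p x.
  by split=> // x; apply: le_trans (rq x) (qp x).
by have /(congr1 sval) := qmin (exist _ r Pr) (introT (asboolP _) rq).
Qed.

(** A minimal sublinear functional is odd, and subadditivity at opposite vectors then gives
    additivity. *)
Lemma sublinear_majorant p : sublinear p ->
  exists f : V -> R, [/\ forall x y, f (x + y) = f x + f y,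
    forall s x, f (s *: x) = s * f x & forall x, f x <= p x].
Proof.
move=> /minimal_sublinear[q [sq qp qmin]]; exists q.
(* Minimality against x |-> inf_(t >= 0) (q (x + t y) - t q y), which is at
   most - q y at - y, makes q odd. *)
have qN y : q (- y) = - q y.
  apply/eqP; rewrite eq_le; apply/andP; split; last first.
    by have := sublinear_geN (- y) sq; rewrite opprK.
  pose S := [set t : R | 0 <= t].
  pose g (t : R) x := q (x + t *: y) - t * q y.
  have lbg x : has_lbound [set g t x | t in S].
    exists (- q (- x)) => _ [t t0 <-]; rewrite /g.
    have := sq.1 (x + t *: y) (- x); rewrite addrAC subrr add0r.
    rewrite (sublinearZ _ sq)//; lra.
  have sr : sublinear (fun x => inf [set g t x | t in S]).
    apply: sublinear_inf => //.
    - by exists 0; rewrite /S /=.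
    - move=> t u x z t0 u0; exists (t + u); first exact: addr_ge0.
      rewrite /g scalerDl addrACA.
      have := sq.1 (x + t *: y) (z + u *: y); lra.
    - move=> t s x t0 s0; exists (s * t); first exact: mulr_ge0.
      by rewrite /g -scalerA -scalerDr (sublinearZ _ sq)// mulrBr mulrA.
  have infg x t : 0 <= t -> inf [set g t x | t in S] <= g t x.
    by move=> t0; apply: ge_inf => //; exists t.
  have rq x : inf [set g t x | t in S] <= q x.
    apply: le_trans (infg _ 0 (lexx _)) _.
    by rewrite /g scale0r addr0 mul0r subr0.
  have {1}-> : q (- y) = inf [set g t (- y) | t in S] by rewrite -(qmin _ sr rq).
  apply: le_trans (infg _ 1 ler01) _.
  by rewrite /g scale1r addNr (sublinear0 sq) mul1r sub0r.
have qD x y : q (x + y) = q x + q y.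
  apply/eqP; rewrite eq_le sq.1/=.
  have := sq.1 (- x) (- y); rewrite -opprD !qN; lra.
split=> // s x; have [s0|/ltW s0] := leP 0 s; first exact: sublinearZ.
have := @sublinearZ q (- s) x sq; rewrite oppr_ge0 => /(_ s0).
rewrite scaleNr qN; lra.
Qed.

End HahnBanach.

(** * Mazur-Orlicz and separation in normed spaces *)

Section DualExtension.
Context {R : realType} (V : normedModType R).

Lemma bounded_linear_dual (f : V -> R) (M : R) : 0 <= M ->
  (forall x y, f (x + y) = f x + f y) -> (forall s x, f (s *: x) = s * f x) ->
  (forall x, `|f x| <= M * `|x|) ->
  exists F : dual V, forall x, F x = f x.
Proof.
move=> M0 fD fZ fM.
have l : linear (f : V -> R^o) by move=> a x y; rewrite fD fZ.
pose e : {linear V -> R^o} := HB.pack (f : V -> R^o)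
  (GRing.isLinear.Build _ _ _ _ _ l).
have ed : (f : V -> R^o) \in @is_dual R V.
  apply/asboolP; split=> //.
  apply: (@bounded_linear_continuous _ _ _ e); apply/bounded_funP => r.
  by exists (M * r) => x xr; apply: le_trans (fM x) _; rewrite ler_wpM2l.
by exists (Dual ed).
Qed.

(* A Mazur-Orlicz theorem: the majorant is inf_((a, b) in K) (M |u + a| - b). *)
Lemma dual_above_cone (K : set (V * R)) (M : R) : 0 <= M -> K (0, 0) ->
  (forall k l, K k -> K l -> K (k.1 + l.1, k.2 + l.2)) ->
  (forall s k, 0 <= s -> K k -> K (s *: k.1, s * k.2)) ->
  (forall k, K k -> k.2 <= M * `|k.1|) ->
  exists f : dual V, forall k, K k -> k.2 <= f k.1.
Proof.
move=> M0 K0 KD KZ KM.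
pose g (k : V * R) u := M * `|u + k.1| - k.2.
have lbg u : has_lbound [set g k u | k in K].
  exists (- (M * `|u|)) => _ [k Kk <-]; rewrite /g.
  have := KM k Kk; have : M * `|k.1| <= M * (`|u + k.1| + `|u|).
    rewrite ler_wpM2l//; apply: le_trans (ler_normB _ _).
    by rewrite addrAC subrr add0r.
  lra.
have sg : sublinear (fun u => inf [set g k u | k in K]).
  apply: sublinear_inf => //.
  - by exists (0, 0).
  - move=> k l x y Kk Kl; exists (k.1 + l.1, k.2 + l.2); first exact: KD.
    have : M * `|x + y + (k.1 + l.1)| <= M * (`|x + k.1| + `|y + l.1|).
      by rewrite ler_wpM2l// addrACA ler_normD.
    rewrite /g /=; lra.
  - move=> k s x Kk s0; exists (s *: k.1, s * k.2); first exact: KZ.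
    rewrite /g /= -scalerDr normrZ (ger0_norm s0); lra.
have [f [fD fZ fg]] := sublinear_majorant sg.
have fk k u : K k -> f u <= M * `|u + k.1| - k.2.
  by move=> Kk; apply: le_trans (fg u) _; apply: ge_inf => //; exists k.
have fN x : f (- x) = - f x by rewrite -scaleN1r fZ mulN1r.
have fM x : `|f x| <= M * `|x|.
  have := fk _ x K0; have := fk _ (- x) K0; rewrite /= !addr0 normrN fN.
  rewrite !subr0 => h1 h2; rewrite ler_norml; apply/andP; split=> //; lra.
have [F Ff] := bounded_linear_dual M0 fD fZ fM.
exists F => k Kk; rewrite Ff; have := fk k (- k.1) Kk.
rewrite addNr normr0 mulr0 fN; lra.
Qed.

(** The cone of pairs [(s *: x - w, s * d)] meets the Mazur-Orlicz condition with constant 1. Its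
    pairs with [s = 0] make [f] vanish on the subspace [W], and the pair with [s = 1], [w = 0] gives
    [d <= f x]. *)
Lemma dual_separation (W : set V) (x : V) (d : R) : 0 < d -> W 0 ->
  (forall u w, W u -> W w -> W (u + w)) ->
  (forall s w, W w -> W (s *: w)) ->
  (forall w, W w -> d <= `|x - w|) ->
  exists f : dual V, (forall w, W w -> f w = 0) /\ 0 < f x.
Proof.
move=> d0 W0 WD WZ Wd.
pose K := [set (s.1 *: x - s.2, s.1 * d) | s in [set s : R * V | 0 <= s.1 /\ W s.2]].
have [| | | | |f fK] := @dual_above_cone K 1.
- by [].
- by exists (0, 0) => //=; rewrite scale0r subr0 mul0r.
- move=> _ _ [[s u] /= [s0 Wu] <-] [[t w] /= [t0 Ww] <-].
  exists (s + t, u + w) => /=; first by split; [exact: addr_ge0|exact: WD].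
  by rewrite scalerDl mulrDl opprD addrACA.
- move=> s _ s0 [[t w] /= [t0 Ww] <-].
  exists (s * t, s *: w) => /=; first by split; [exact: mulr_ge0|exact: WZ].
  by rewrite -scalerA -scalerBr mulrA.
- move=> _ [[t w] /= [t0 Ww] <-]; rewrite mul1r.
  move: t0; rewrite le_eqVlt => /predU1P[<-|t0]; first by rewrite mul0r normr_ge0.
  have -> : t *: x - w = t *: (x - t^-1 *: w).
    by rewrite scalerBr scalerA divff ?gt_eqF// scale1r.
  by rewrite normrZ gtr0_norm// ler_pM2l// Wd//; exact: WZ.
have fW w : W w -> f w <= 0.
  move=> Ww; have /fK /= : K (0 *: x - w, 0 * d) by exists (0, w).
  by rewrite mul0r scale0r sub0r linearN => h; rewrite -oppr_ge0.
exists f; split=> [w Ww|].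
  apply/eqP; rewrite eq_le fW//=; have := fW (-1 *: w) (WZ _ _ Ww).
  by rewrite scaleN1r linearN oppr_le0.
have /fK /= : K (1 *: x - 0, 1 * d) by exists (1, 0).
by rewrite mul1r scale1r subr0; exact: lt_le_trans.
Qed.

End DualExtension.

(** * Algebra and estimates of the duality pairing *)

Section DualPairing.
Context {R : realType} (X : normedModType R).
Implicit Types (f g : dual X).

Lemma dualDr f (x y : X) : f (x + y) = f x + f y.
Proof. exact: linearD. Qed.

Lemma dualBr f (x y : X) : f (x - y) = f x - f y.
Proof. exact: linearB. Qed.

Lemma dualNr f (x : X) : f (- x) = - f x.
Proof. exact: linearN. Qed.

Lemma dualBl f g (x : X) : (f - g) x = f x - g x.
Proof. by []. Qed.

Lemma dualZr f (s : R) (x : X) : f (s *: x) = s * f x.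
Proof. by rewrite linearZ. Qed.

Lemma ler_pairing f (x : X) : f x <= `|f| * `|x| :> R.
Proof. exact: le_trans (ler_norm _) (ler_dual_norm f x). Qed.

(** A one-sided bound suffices because the ball is symmetric; monotonicity inequalities in all small
    directions thereby become norm bounds. *)
Lemma dual_norm_le_ball f (s K : R) : 0 < s ->
  (forall e, `|e| <= s -> f e <= K) -> `|f| <= K / s.
Proof.
move=> s0 fK; apply: dual_norm_le => x x1.
have h e : `|e| <= 1 -> f e <= K / s.
  move=> e1; rewrite ler_pdivlMr// mulrC -dualZr.
  by apply: fK; rewrite normrZ gtr0_norm// ler_piMr// ltW.
rewrite ler_norml h// andbT lerNl -dualNr h// normrN //.
Qed.

End DualPairing.

(** * Maximality and points of the domain along segments *)

Section MonotoneTheory.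
Context {R : realType} (X : normedModType R) (A : X -> set (dual X)).

(** Otherwise adjoining [(z, zs)] would properly enlarge the graph and keep it monotone. *)
Lemma maximal_monotoneP (z : X) (zs : dual X) : maximal_monotone A ->
  (forall y ys, A y ys -> 0 <= ((zs - ys) (z - y) : R)) -> A z zs.
Proof.
move=> [mA maxA] Az; apply: contrapT => nA; apply: maxA.
exists (fun y => A y `|` [set ys | y = z /\ ys = zs]); split.
  move=> x y xs ys [Ax|[-> ->]] [Ay|[-> ->]].
  - exact: mA.
  - rewrite -opprB -(opprB z) dualNr.
    by rewrite -[X in _ <= X]/(- - (zs - xs) (z - x)) opprK; exact: Az.
  - exact: Az.
  - by rewrite (subrr z) linear0.
split; first by move=> [y ys] /= Ay; left.
by move=> /(_ (z, zs)) /=; apply: contra_not nA; apply; right.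
Qed.

(* Quadruples (y, ys, p, l) stand for the l-fold of a convex combination of
   graph points, with y and ys the sums of the points and of the functionals
   and p the sum of the pairings. The pairing inequality below is bilinear, so
   its bipolar of the graph is a convex cone on which it holds. *)
Definition graph_polar (y : X) (ys : dual X) (p l : R) :=
  0 <= l /\ forall a as_, A a as_ -> ys a + as_ y <= p + l * as_ a.

Definition graph_bipolar (y : X) (ys : dual X) (p l : R) :=
  graph_polar y ys p l /\ forall y' ys' p' l', graph_polar y' ys' p' l' ->
    ys y' + ys' y <= l' * p + l * p'.

Lemma graph_polar_graph y ys : monotone_operator A -> A y ys ->
  graph_polar y ys (ys y) 1.
Proof.
move=> mA Ay; split=> // a as_ Aa; have := mA _ _ _ _ Ay Aa.
rewrite dualBl !dualBr.
by rewrite mul1r; lra.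
Qed.

Lemma graph_bipolar_graph y ys : monotone_operator A -> A y ys ->
  graph_bipolar y ys (ys y) 1.
Proof.
move=> mA Ay; split; first exact: graph_polar_graph.
by move=> y' ys' p' l' [_ /(_ _ _ Ay)]; rewrite mul1r; lra.
Qed.

Lemma graph_polarD y ys p l y' ys' p' l' :
  graph_polar y ys p l -> graph_polar y' ys' p' l' ->
  graph_polar (y + y') (ys + ys') (p + p') (l + l').
Proof.
move=> [l0 H] [l0' H']; split=> [|a as_ Aa]; first exact: addr_ge0.
rewrite dualDr -[(ys + ys') a]/(ys a + ys' a) mulrDl.
by have := H _ _ Aa; have := H' _ _ Aa; lra.
Qed.

Lemma graph_polarZ s y ys p l : 0 <= s -> graph_polar y ys p l ->
  graph_polar (s *: y) (s *: ys) (s * p) (s * l).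
Proof.
move=> s0 [l0 H]; split=> [|a as_ Aa]; first exact: mulr_ge0.
rewrite dualZr -[(s *: ys) a]/(s * ys a).
by rewrite -mulrA -!mulrDr ler_wpM2l// H.
Qed.

Lemma graph_bipolarD y ys p l y' ys' p' l' :
  graph_bipolar y ys p l -> graph_bipolar y' ys' p' l' ->
  graph_bipolar (y + y') (ys + ys') (p + p') (l + l').
Proof.
move=> [S H] [S' H']; split; first exact: graph_polarD.
move=> b bs q m /[dup] /H h /H' h'; rewrite dualDr.
by rewrite -[(ys + ys') b]/(ys b + ys' b) mulrDl mulrDr; lra.
Qed.

Lemma graph_bipolarZ s y ys p l : 0 <= s -> graph_bipolar y ys p l ->
  graph_bipolar (s *: y) (s *: ys) (s * p) (s * l).
Proof.
move=> s0 [S H]; split=> [|b bs q m /H h]; first exact: graph_polarZ.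
rewrite dualZr -[(s *: ys) b]/(s * ys b).
by rewrite mulrCA -mulrA -!mulrDr ler_wpM2l.
Qed.

Lemma graph_bipolar0 : graph_bipolar 0 0 0 0.
Proof.
split; last by move=> y' ys' p' l' _; rewrite linear0 mul0r mulr0.
by split=> // a as_ _; rewrite linear0 mul0r.
Qed.

(** A bipolar element is polar, hence can be tested against itself. For convex combinations of graph
    points: the pairing of the means is at most the mean of the pairings. *)
Lemma graph_bipolar_self y ys p l : graph_bipolar y ys p l -> ys y <= l * p.
Proof. by move=> [S /(_ _ _ _ _ S)]; lra. Qed.

(** Polarity is tested at the single graph point [(a, as_)], which enters the bound only through [K]
    and [B]; one constant thus serves a whole family of graph points. *)
Lemma graph_polar_le (B K : R) a as_ y ys p l : 0 <= K -> A a as_ ->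
  `|as_| <= K -> `|a| <= B -> graph_polar y ys p l ->
  ys a - p <= K * (1 + B) * (l + `|y|).
Proof.
move=> K0 Aa asK aB [l0 /(_ _ _ Aa) h].
have B0 : 0 <= B by apply: le_trans aB.
have h1 : - as_ y <= K * `|y|.
  rewrite -dualNr; apply: le_trans (ler_pairing _ _) _.
  by rewrite normrN ler_wpM2r.
have h2 : as_ a <= K * B.
  by apply: le_trans (ler_pairing _ _) _; rewrite ler_pM.
have h3 : l * as_ a <= l * (K * B) by rewrite ler_wpM2l.
have h4 : 0 <= K * l by apply: mulr_ge0.
have h5 : 0 <= K * `|y| by apply: mulr_ge0.
have h6 : 0 <= K * `|y| * B by apply: mulr_ge0.
have -> : K * (1 + B) * (l + `|y|) =
  K * l + K * `|y| + l * (K * B) + K * `|y| * B by ring.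
lra.
Qed.

(** Bounded graph points at [x] and around [x + v] control polar elements on a ball around
    [x + t *: v]. This gives the estimate [key] that [dual_above_cone] asks for. *)
Lemma maximal_monotone_segment (x v : X) (xs : dual X) (s K t : R) :
  maximal_monotone A -> A x xs -> 0 < s -> 0 <= K ->
  (forall u, `|u - v| <= s -> exists2 us, A (x + u) us & `|us| <= K) ->
  0 < t <= 1 -> domain A (x + t *: v).
Proof.
move=> maxA Ax s0 K0 Av /andP[t0 t1].
have mA := maxA.1.
set z := x + t *: v.
(* [B] and the first factor of [C] dominate the points and the functionals, both at [x] and at the
   points [x + u]. *)
pose B := `|x| + (`|v| + s).
pose C := (K + `|xs|) * (1 + B).
pose r := t * s.
have r0 : 0 < r by apply: mulr_gt0.
have B0 : 0 <= B by rewrite /B !addr_ge0// ltW.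
have C0 : 0 <= C by rewrite /C mulr_ge0// addr_ge0.
have bound y ys p l e : graph_polar y ys p l -> `|e| <= r ->
    ys (z + e) - p <= C * (l + `|y|).
  move=> S er; pose e' := t^-1 *: e.
  have e's : `|v + e' - v| <= s.
    rewrite addrAC subrr add0r normrZ gtr0_norm ?invr_gt0//.
    by rewrite ler_pdivrMl.
  have [us Au usK] := Av _ e's.
  have xh : ys x - p <= C * (l + `|y|).
    apply: graph_polar_le Ax _ _ S; first exact: addr_ge0.
      by rewrite lerDr.
    by rewrite /B lerDl addr_ge0// ltW.
  have ah : ys (x + (v + e')) - p <= C * (l + `|y|).
    apply: graph_polar_le Au _ _ S; first exact: addr_ge0.
      by rewrite (le_trans usK)// lerDl.
    apply: le_trans (ler_normD _ _) _; rewrite /B lerD2l.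
    apply: le_trans (ler_normD _ _) _; rewrite lerD2l.
    by move: e's; rewrite addrAC subrr add0r.
  (* The estimates at [x] and at [x + (v + e')] are averaged with weights [1 - t] and [t]. *)
  have -> : z + e = (1 - t) *: x + t *: (x + (v + e')).
    rewrite !scalerDr scalerA divff ?gt_eqF// scale1r scalerBl scale1r.
    by rewrite addrA subrK addrA.
  rewrite dualDr !dualZr.
  move: xh ah; set c := C * _; set X1 := ys x; set X2 := ys (x + _) => xh ah.
  have : (1 - t) * (X1 - p) <= (1 - t) * c by rewrite ler_wpM2l// subr_ge0.
  have : t * (X2 - p) <= t * c by rewrite ler_wpM2l// ltW.
  lra.
clearbody z.
(* [M] ensures [C * (l + l * |z| + d) <= (r * l + d) * M] for all nonnegative [l] and [d]. *)
pose M := C * (1 + (1 + `|z|) / r).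
have M0 : 0 <= M.
  by rewrite /M mulr_ge0// addr_ge0// divr_ge0 ?addr_ge0// ltW.
have key y ys p l : graph_bipolar y ys p l -> ys z - p <= M * `|l *: z - y|.
  move=> /[dup] /graph_bipolar_self yy [S _]; have l0 := S.1.
  set d := `|l *: z - y|; pose e := d^-1 *: (l *: z - y).
  have d0 : 0 <= d by exact: normr_ge0.
  have e1 : `|e| <= 1.
    rewrite normrZ normfV normr_id -/d.
    by have [->|d1] := eqVneq d 0; rewrite ?mulr0// mulVf.
  have de : d *: e = l *: z - y.
    rewrite /e scalerA; have [d1|d1] := eqVneq d 0; last by rewrite divff// scale1r.
    by rewrite d1 mul0r scale0r; apply/esym/normr0_eq0.
  clearbody e.
  have yd : `|y| <= l * `|z| + d.
    have -> : y = l *: z - (l *: z - y) by rewrite opprB addrC subrK.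
    by apply: le_trans (ler_normB _ _) _; rewrite normrZ ger0_norm.
  have : 0 <= r * l + d by rewrite addr_ge0// mulr_ge0// ltW.
  (* In the degenerate case [l = 0], [y = 0], the estimate [bound] at [e = 0] already gives the
     claim. *)
  rewrite le_eqVlt => /predU1P[/esym/eqP|rd].
    rewrite paddr_eq0//; last by rewrite mulr_ge0// ltW.
    rewrite mulf_eq0 gt_eqF//= => /andP[/eqP l00 /eqP d00].
    have := bound _ _ _ _ 0 S; rewrite normr0 addr0 => /(_ (ltW r0)).
    have -> : `|y| = 0.
      by apply/eqP; rewrite eq_le normr_ge0 andbT (le_trans yd)// l00 d00 mul0r addr0.
    by rewrite l00 d00 addr0 !mulr0.
  have h := bound _ _ _ _ (r *: e) S.
  have /h {}h : `|r *: e| <= r by rewrite normrZ gtr0_norm// ler_piMr// ltW.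
  (* For [l > 0], [z] lies between [y / l] and [z + r e]; this division-free form also covers
     [l = 0]. [graph_bipolar_self] controls the first end and [bound] the second. *)
  have E : (r * l + d) *: z = r *: y + d *: (z + r *: e).
    have -> : d *: (z + r *: e) = d *: z + r *: (d *: e).
      by rewrite scalerDr !scalerA (mulrC d).
    rewrite de scalerBr scalerDl scalerA addrC; set a := d *: z.
    by rewrite [RHS]addrC -addrA subrK.
  have Eys : (r * l + d) * ys z = r * ys y + d * ys (z + r *: e).
    by rewrite -dualZr E (dualDr _ (r *: y)) !(dualZr ys _ y) (dualZr _ d).
  rewrite -(ler_pM2l rd).
  have h1 : d * (ys (z + r *: e) - p) <= d * (C * (l + `|y|)) by rewrite ler_wpM2l.
  have h2 : C * (l + `|y|) <= C * (l + (l * `|z| + d)) by rewrite ler_wpM2l// lerD2l.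
  have h3 : d * (C * (l + `|y|)) <= d * (C * (l + (l * `|z| + d))) by rewrite ler_wpM2l.
  have h4 : r * ys y <= r * (l * p) by rewrite ler_wpM2l// ltW.
  have h5 : (r * l + d) * (M * d) = d * (C * (l + (l * `|z| + d)))
     + d * C * (r * l) + d * C * d * (1 + `|z|) / r.
    by rewrite /M; field; rewrite gt_eqF.
  have h6 : 0 <= d * C * (r * l).
    by do 2 ?apply: mulr_ge0 => //; apply: ltW.
  have h7 : 0 <= d * C * d * (1 + `|z|) / r.
    by rewrite divr_ge0 ?(ltW r0)// !mulr_ge0// addr_ge0.
  rewrite h5 mulrBr Eys; lra.
(* At a graph point, where [l = 1], a functional above this cone satisfies
   [ys z - ys y <= f (z - y)], which is the relation required by [maximal_monotoneP]. *)
pose Kc : set (X * R) := [set q | exists y ys p l,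
  graph_bipolar y ys p l /\ q = (l *: z - y, ys z - p)].
have [| | | | |f fK] := @dual_above_cone _ X Kc M.
- by [].
- exists 0, 0, 0, 0; split; first exact: graph_bipolar0.
  by rewrite scale0r !subr0.
- move=> _ _ [y [ys [p [l [S ->]]]]] [y' [ys' [p' [l' [S' ->]]]]] /=.
  exists (y + y'), (ys + ys'), (p + p'), (l + l'); split.
    exact: graph_bipolarD.
  rewrite -[(ys + ys') z]/(ys z + ys' z) scalerDl !opprD.
  by rewrite addrACA; congr pair; lra.
- move=> c _ c0 [y [ys [p [l [S ->]]]]] /=.
  exists (c *: y), (c *: ys), (c * p), (c * l); split.
    exact: graph_bipolarZ.
  by rewrite -[(c *: ys) z]/(c * ys z) -scalerA -scalerBr -mulrBr.
- by move=> _ [y [ys [p [l [S ->]]]]] /=; exact: key.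
exists f; apply: maximal_monotoneP => // y ys Ay.
have : ys z - ys y <= f (1 *: z - y).
  apply: (fK (_, _)); exists y, ys, (ys y), 1; split=> //.
  exact: graph_bipolar_graph.
by rewrite scale1r dualBl (dualBr ys) subr_ge0.
Qed.

End MonotoneTheory.

(** * Local boundedness by Baire category *)

Section LocalBoundedness.
Context {R : realType} (X : completeNormedModType R) (A : X -> set (dual X)).

(** For fixed [u] in the domain, monotonicity bounds [ys (u - y)] over graph points near [p], so
    Baire gives a uniform bound around some [u0]. One point [q] on the other side of [p] transfers
    it to [p]. *)
Lemma monotone_locally_bounded (p : X) (r : R) : monotone_operator A ->
  0 < r -> (forall u, `|u - p| < r -> domain A u) ->
  exists s K : R, [/\ 0 < s, 0 <= K &
    forall y ys, `|y - p| <= s -> A y ys -> `|ys| <= K].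
Proof.
move=> mA r0 Ap.
pose G := [set q : X * dual X | A q.1 q.2 /\ `|q.1 - p| <= 1].
pose U (n : nat) := \bigcup_(q in G) [set u : X | n%:R < (q.2 (u - q.1) : R)].
have oU n : open (U n).
  apply: bigcup_open => q _.
  have cq : continuous (fun u : X => q.2 (u - q.1) : R).
    move=> u; apply: (@continuous_comp _ _ _ (fun u : X => u - q.1) q.2).
      by apply: cvgB; [exact: cvg_id|exact: cvg_cst].
    exact: dual_continuous.
  have -> : [set u : X | n%:R < (q.2 (u - q.1) : R)] =
     (fun u : X => q.2 (u - q.1) : R) @^-1` [set y | n%:R < y] by [].
  apply: open_comp => [u _|]; [exact: cq|exact: open_gt].
have domU u : domain A u -> exists K : R, forall y ys, A y ys -> `|y - p| <= 1 ->
    ys (u - y) <= K.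
  move=> [us Au]; exists (`|us| * (`|u - p| + 1)) => y ys Ay yp.
  have := mA _ _ _ _ Au Ay.
  rewrite dualBl subr_ge0 => h.
  apply: le_trans h _; apply: le_trans (ler_pairing _ _) _.
  rewrite ler_wpM2l//.
  have -> : u - y = (u - p) - (y - p) by rewrite opprB addrA subrK.
  by apply: le_trans (ler_normB _ _) _; rewrite lerD2l.
have [n [Oo [[u0 Ou0] oO OU]]] : exists n O, [/\ O !=set0, open O & O `&` U n = set0].
  apply: contrapT => nU.
  have dU : dense (\bigcap_i U i).
    apply: Baire => i; split=> // O O0 oO; apply/set0P/eqP => OU.
    by apply: nU; exists i, O.
  have [|u [/=]] := dU (ball p r) _ (ball_open _ _).
    by exists p; exact: ballxx.
  rewrite -ball_normE /= distrC => /Ap /domU [K uK] /(_ (Num.truncn `|K|).+1 I)[[y ys] [/= Ay yp]].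
  apply/negP; rewrite -leNgt (le_trans (uK _ _ Ay yp))//.
  by rewrite (le_trans (ler_norm _))// ltW// truncnS_gt.
have /nbhs_normP[s /= s0 sO] : nbhs u0 Oo by apply: open_nbhs_nbhs.
have bO u y ys : `|u - u0| < s -> A y ys -> `|y - p| <= 1 -> ys (u - y) <= n%:R.
  move=> us Ay yp; rewrite leNgt; apply/negP => nu.
  have : (Oo `&` U n) u.
    split; last by exists (y, ys).
    by apply: sO; rewrite /= distrC.
  by rewrite OU.
(* This [c] keeps [q] within [r] of [p], and [(1 + c) p = q + c u0]. *)
pose c := r / (2 * (1 + `|p - u0|)).
have c0 : 0 < c by rewrite divr_gt0// mulr_gt0// ltr_pwDl.
pose q := p + c *: (p - u0).
have [Kq qK] : exists K : R, forall y ys, A y ys -> `|y - p| <= 1 -> ys (q - y) <= K.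
  apply: domU; apply: Ap; rewrite /q addrAC subrr add0r normrZ gtr0_norm//.
  rewrite /c mulrAC ltr_pdivrMr ?mulr_gt0 ?ltr_pwDl// ltr_pM2l//.
  by have := normr_ge0 (p - u0); lra.
(* If [|e|] and [(1 + c) |p - y|] are at most [h], the vector [e'] below has norm at most
   [2 h / c = s / 2]. *)
pose h := c * s / 4.
have h0 : 0 < h by rewrite divr_gt0// mulr_gt0.
pose s' := Num.min 1 (h / (1 + c)).
have s'0 : 0 < s' by rewrite lt_min ltr01 divr_gt0// addr_gt0.
exists s', (`|Kq + c * n%:R| / h); split=> //; first by rewrite divr_ge0// ltW.
move=> y ys yp Ay.
have y1 : `|y - p| <= 1 by rewrite (le_trans yp)// ge_min lexx.
have yh : (1 + c) * `|p - y| <= h.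
  rewrite mulrC -ler_pdivlMr ?addr_gt0// distrC (le_trans yp)//.
  by rewrite ge_min lexx orbT.
apply: dual_norm_le_ball => // e eh.
apply: le_trans (ler_norm _).
(* [e'] solves [e = (q - y) + c (u0 + e' - y)], so that the bounds at [q] and near [u0] add up. *)
pose e' := c^-1 *: (e - (1 + c) *: (p - y)).
have e's : `|u0 + e' - u0| < s.
  rewrite addrAC subrr add0r normrZ gtr0_norm ?invr_gt0// ltr_pdivrMl//.
  apply: le_lt_trans (ler_normB _ _) _.
  rewrite normrZ gtr0_norm ?addr_gt0//.
  have : h < c * s / 2 by rewrite /h; have := mulr_gt0 c0 s0; lra.
  rewrite /h in eh yh *; lra.
have h1 := bO _ _ _ e's Ay y1.
have h2 := qK _ _ Ay y1.
have E : e = (q - y) + c *: (u0 + e' - y).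
  have ce' : c *: e' = e - (1 + c) *: (p - y).
    by rewrite /e' scalerA divff ?gt_eqF// scale1r.
  have -> : q - y = (1 + c) *: (p - y) - c *: (u0 - y).
    rewrite scalerDl scale1r -[RHS]addrA -scalerBr opprB (addrA (p - y)) subrK.
    by rewrite /q addrAC.
  by rewrite [u0 + e' - y]addrAC (scalerDr c (u0 - y) e') ce' addrA subrK addrC subrK.
rewrite {}E dualDr dualZr.
by rewrite lerD// ler_pM2l.
Qed.

End LocalBoundedness.

(** * Limits along ultrafilters *)

Section UltraLimits.
Context {R : realType} (T : Type) (U : set_system T) {UU : UltraFilter U}.

(** Compactness of [[-K, K]] gives a cluster point, and an ultrafilter converges to its cluster
    points. *)
Lemma bounded_ultra_limit (f : T -> R) (K : R) :
  (forall t, `|f t| <= K) -> exists l : R, f @ U --> l.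
Proof.
move=> fK.
have [|l [_ fl]] := @segment_compact R (- K) K (f @ U) _.
  by apply: (@filterS _ U _ setT) filterT => t _; rewrite /= in_itv /= -ler_norml.
exists l => B Bl; have [//|nB] := in_ultra_setVsetC (f @^-1` B) UU.
by have [y [] /=] := fl (~` B) B nB Bl.
Qed.

(** Banach-Alaoglu in filter form: pointwise limits inherit linearity and the bound [K]. *)
Lemma dual_ultra_limit (X : normedModType R) (f : T -> dual X) (K : R) :
  0 <= K -> (forall t, `|f t| <= K) ->
  exists F : dual X, forall x, (f t x : R) @[t --> U] --> (F x : R).
Proof.
move=> K0 fK.
have fx t x : `|f t x : R| <= K * `|x|.
  by apply: le_trans (ler_dual_norm _ _) _; rewrite ler_wpM2r//; exact: fK.
have /choice[F Ff] x : exists l : R, (f t x : R) @[t --> U] --> l.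
  by apply: (@bounded_ultra_limit _ (K * `|x|)) => t.
have FD x y : F (x + y) = F x + F y.
  apply: (@cvg_unique _ (@Rhausdorff R) _ _ _ _ (Ff (x + y))).
  have -> : (fun t => f t (x + y) : R) = (fun t => (f t x : R) + (f t y : R)).
    by apply/funext => t; rewrite dualDr.
  exact: cvgD (Ff x) (Ff y).
have FZ s x : F (s *: x) = s * F x.
  apply: (@cvg_unique _ (@Rhausdorff R) _ _ _ _ (Ff (s *: x))).
  have -> : (fun t => f t (s *: x) : R) = (fun t => s * (f t x : R)).
    by apply/funext => t; rewrite dualZr.
  exact: cvgM (cvg_cst _) (Ff x).
have FK x : `|F x| <= K * `|x|.
  apply/ler_addgt0Pr => e e0.
  have /cvgrPdist_lt/(_ e e0)/filter_ex[t Ft] := Ff x.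
  have -> : F x = f t x + (F x - f t x) by rewrite addrC subrK.
  by apply: le_trans (ler_normD _ _) _; rewrite lerD// ltW.
have [G GF] := bounded_linear_dual K0 FD FZ FK.
by exists G => x; rewrite GF; exact: Ff.
Qed.

End UltraLimits.

(** * The closed span of a sequence *)

Section RationalSpan.
Context {R : realType} (V : normedModType R) (f : nat -> V).

(* Rational combinations are indexed by lists of (coefficient, index) pairs,
   so that sums are concatenations. *)
Definition rat_comb (s : seq (rat * nat)) : V :=
  \sum_(q <- s) ratr q.1 *: f q.2.

(** This is the closed real span, presented by rational combinations so that the approximants are
    countable and allow a diagonal extraction. *)
Definition rat_span : set V :=
  [set v | forall e : R, 0 < e -> exists s, `|v - rat_comb s| < e].

Lemma rat_span_gen n : rat_span (f n).
Proof.
move=> e e0; exists [:: (1, n)]; rewrite /rat_comb big_seq1/=.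
by rewrite rmorph1 scale1r subrr normr0.
Qed.

Lemma rat_span0 : rat_span 0.
Proof. by move=> e e0; exists [::]; rewrite /rat_comb big_nil subr0 normr0. Qed.

Lemma rat_spanD u v : rat_span u -> rat_span v -> rat_span (u + v).
Proof.
move=> Su Sv e e0; have e2 : 0 < e / 2 by rewrite divr_gt0.
have [s us] := Su _ e2; have [t vt] := Sv _ e2; exists (s ++ t).
rewrite /rat_comb big_cat /= opprD addrACA.
by apply: le_lt_trans (ler_normD _ _) _; rewrite [e]splitr ltrD.
Qed.

(** Each real coefficient is replaced by a rational within [e / (1 + |f i|)], the 1 guarding against
    [f i = 0]. *)
Lemma rat_combZ c s : rat_span (c *: rat_comb s).
Proof.
elim: s => [|[q i] s IH]; first by rewrite /rat_comb big_nil scaler0; exact: rat_span0.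
rewrite /rat_comb big_cons scalerDr; apply: rat_spanD => // {IH} e e0 /=.
pose d := e / (1 + `|f i|).
have d0 : 0 < d by rewrite divr_gt0// ltr_pwDl.
have [q'] := @rat_in_itvoo R (c * ratr q - d) (c * ratr q + d) ltac:(lra).
rewrite in_itv /= => /andP[q1 q2].
exists [:: (q', i)]; rewrite /rat_comb big_seq1 /= scalerA -scalerBl normrZ.
apply: le_lt_trans (_ : d * `|f i| < e).
  by rewrite ler_wpM2r// ler_norml; apply/andP; split; lra.
rewrite /d mulrAC ltr_pdivrMr ?ltr_pwDl// ltr_pM2l//.
by rewrite ltrDr.
Qed.

Lemma rat_spanZ c v : rat_span v -> rat_span (c *: v).
Proof.
move=> Sv e e0; have e2 : 0 < e / 2 by rewrite divr_gt0.
have c0 : 0 < 1 + `|c| by rewrite ltr_pwDl.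
have [s vs] := Sv (e / 2 / (1 + `|c|)) (divr_gt0 e2 c0).
have [t st] := rat_combZ c s e2; exists t.
have -> : c *: v - rat_comb t = c *: (v - rat_comb s) + (c *: rat_comb s - rat_comb t).
  by rewrite scalerBr addrA subrK.
apply: le_lt_trans (ler_normD _ _) _; rewrite [e]splitr ler_ltD// normrZ.
move: vs; rewrite ltr_pdivlMr// => /ltW; apply: le_trans.
by rewrite mulrC ler_wpM2l// lerDr.
Qed.

End RationalSpan.

(** * Weak sequential compactness in the dual of a reflexive space *)

Section ReflexiveCompactness.
Context {R : realType} (X : normedModType R).

Lemma dual_almost_norming (g : dual X) :
  exists2 x, `|x| <= 1 & `|g| <= 2 * `|g x : R|.
Proof.
have [g0|g0] := eqVneq (`|g|) 0; first by exists 0; rewrite ?g0 ?normr0 ?mulr_ge0.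
have gp : 0 < `|g| / 2 by rewrite divr_gt0// lt_neqAle eq_sym g0 normr_ge0.
have [_ [x /= x1 <-] gx] := sup_adherent gp (dual_norm_has_sup g).
exists x => //; move: gx; rewrite -/(dual_norm g) -[dual_norm g]/(`|g|); lra.
Qed.

(** A functional outside the closed span is separated from it by some [phi] in the bidual; by
    reflexivity [phi] is evaluation at a point killed by every [f n] but not by [F]. *)
Lemma rat_span_annihilator (f : nat -> dual X) (F : dual X) :
  reflexive_space X ->
  (forall x, (forall n, f n x = 0) -> F x = 0) -> rat_span f F.
Proof.
move=> reflX FN; apply: contrapT => /existsNP[e /not_implyP[e0 /forallNP He]].
have [||||w fw|phi [phi0 phiF]] := @dual_separation _ (dual X) (rat_span f) F (e / 2).
- by rewrite divr_gt0.
- exact: rat_span0.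
- exact: rat_spanD.
- exact: rat_spanZ.
- rewrite leNgt; apply/negP => Fw.
  have [s ws] := fw (e / 2) ltac:(by rewrite divr_gt0).
  apply: (He s); have -> : F - rat_comb f s = (F - w) + (w - rat_comb f s).
    by rewrite addrA subrK.
  by apply: le_lt_trans (ler_normD _ _) _; rewrite [e]splitr ltrD.
have [x xphi] := reflX phi; move: phiF; rewrite -xphi /= FN ?ltxx//.
by move=> n; have := phi0 _ (rat_span_gen f n); rewrite -xphi.
Qed.

(** [X] may be nonseparable, so the diagonal extraction runs over countably many points [x s] that
    almost norm the rational combinations. The candidate [F] is a limit of [f] along an
    ultrafilter. *)
Lemma bounded_dual_weakly_cvg (f : nat -> dual X) (K : R) :
  reflexive_space X ->
  (forall n, `|f n| <= K) ->
  exists (k : nat -> nat) (F : dual X),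
    (forall n, (n <= k n)%N) /\ weakly_cvg (fun n => f (k n)) F.
Proof.
move=> reflX fK; have K0 : 0 <= K := le_trans (normr_ge0 _) (fK 0%N).
have /choice[x xP] s : exists y, `|y| <= 1 /\
    `|rat_comb f s| <= 2 * `|rat_comb f s y : R|.
  by have [y y1 ys] := dual_almost_norming (rat_comb f s); exists y.
(* The points x s together with the common kernel of the f n separate the
   weak cluster points of f. *)
have dual_eq0 (F : dual X) : (forall y, (forall n, f n y = 0) -> F y = 0) ->
    (forall s, F (x s) = 0) -> F = 0.
  move=> /(rat_span_annihilator reflX) FS Fx; apply: normr0_eq0.
  apply/eqP; rewrite eq_le normr_ge0 andbT; apply/ler_addgt0Pr => e e0.
  (* Let [g] be the rational combination. As [F (x s) = 0], [|g (x s)| <= |F - g|], hence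
     [|F| <= 3 |F - g|]. *)
  have [s Fs] := FS (e / 3) ltac:(by rewrite divr_gt0).
  have [xs1 gs] := xP s; rewrite add0r.
  have h : `|rat_comb f s (x s) : R| <= `|F - rat_comb f s|.
    have -> : rat_comb f s (x s) = - ((F - rat_comb f s) (x s)).
      by rewrite dualBl Fx sub0r opprK.
    by rewrite normrN; apply: ler_dual_norm1.
  have : `|F| <= `|F - rat_comb f s| + `|rat_comb f s|.
    by apply: le_trans (ler_normD _ _); rewrite subrK.
  lra.
have [U [UU oU]] := @ultraFilterLemma nat \oo _.
have [F Ff] := @dual_ultra_limit R nat U UU X f K K0 fK.
have Fnear (e : R) : 0 < e -> forall n, U [set m | forall s,
    (pickle s < n)%N -> `|(F (x s) : R) - f m (x s)| < e].
  move=> e0; elim=> [|n IH]; first by apply: filterS filterT => m _.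
  have Un : U [set m | forall s, pickle s = n -> `|(F (x s) : R) - f m (x s)| < e].
    (* At most one list has code [n], so each induction step adds at most one condition. *)
    have [[s0 s0n]|ns] := pselect (exists s : seq (rat * nat), pickle s = n).
      have /cvgrPdist_lt/(_ e e0) := Ff (x s0); apply: filterS => m ms s.
      by rewrite -s0n => /(pcan_inj pickleK) ->.
    by apply: filterS filterT => m _ s sn; case: ns; exists s.
  apply: filterS (filterI IH Un) => m [IHm Hm] s.
  by rewrite ltnS leq_eqVlt => /predU1P[/Hm|/IHm].
have /choice[k kP] n : exists m, (n <= m)%N /\ forall s,
    (pickle s < n)%N -> `|(F (x s) : R) - f m (x s)| < n.+1%:R^-1.
  have n0 : 0 < n.+1%:R^-1 :> R by rewrite invr_gt0.
  have [m [nm Hm]] := filter_ex (filterI (oU _ (nbhs_infty_ge n)) (Fnear _ n0 n)).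
  by exists m.
have kx s : (f (k n) (x s) : R) @[n --> \oo] --> (F (x s) : R).
  apply/cvgrPdist_lt => e e0; near=> n.
  have sn : (pickle s < n)%N by near: n; exact: nbhs_infty_gt.
  apply: lt_trans ((kP n).2 s sn) _.
  by near: n; exact: near_infty_natSinv_lt (PosNum e0).
exists k, F; split=> [n|phi]; first exact: (kP n).1.
have [y <-] := reflX phi; apply/cvgrPdist_lt => e e0 /=.
(* If convergence at [y] failed, the bad indices would meet every tail. An ultrafilter on them
   yields a limit [G] that must equal [F] yet stays [e] away from it at [y]. *)
apply: contrapT => nE; pose E := [set n | e <= `|(F y : R) - f (k n) y|].
have PE : ProperFilter (within E \oo).
  apply: Build_ProperFilter; rewrite /within /= => oE; apply: nE.
  by apply: filterS oE => n /=; rewrite /E /= leNgt => /negP/negPn.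
have [V [VV EV]] := ultraFilterLemma PE.
have oV : \oo `<=` V by move=> B oB; apply: EV; apply: filterS oB => n Bn _.
have [G Gf] := @dual_ultra_limit R nat V VV X (fun n => f (k n)) K K0 (fun n => fK _).
have GF : G = F.
  apply/eqP; rewrite -subr_eq0; apply/eqP; apply: dual_eq0 => [z fz|s].
    have -> : (G - F) z = G z - F z by [].
    have -> : (G z : R) = 0.
      apply: (@cvg_unique _ (@Rhausdorff R) _ _ _ _ (Gf z)).
      by apply: cvg_near_cst; apply: filterS filterT => n _; exact: fz.
    have -> : (F z : R) = 0.
      apply: (@cvg_unique _ (@Rhausdorff R) _ _ _ _ (Ff z)).
      by apply: cvg_near_cst; apply: filterS filterT => n _; exact: fz.
    by rewrite subrr.
  rewrite dualBl; apply/eqP; rewrite subr_eq0; apply/eqP.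
  apply: (@cvg_unique _ (@Rhausdorff R) _ _ _ _ (Gf (x s))).
  by move=> B /kx; exact: oV.
have VE : V E by apply: EV; exact: withinT.
have /cvgrPdist_lt/(_ e e0) := Gf y; rewrite GF => /(filterI VE)/filter_ex[n [/=]].
by rewrite /E /= => /le_lt_trans/[apply]; rewrite ltxx.
Unshelve. all: by end_near. Qed.

End ReflexiveCompactness.

(** * Limits of pairings and bounds along a direction *)

(** The difference splits as [(F - f n) v + f n (v - w n)]: weak convergence tested on [bidual v]
    handles the first term, boundedness the second. *)
Lemma weakly_cvg_pairing (R : realType) (X : normedModType R)
    (f : nat -> dual X) (F : dual X) (w : nat -> X) (v : X) (K : R) : 0 <= K ->
  (\forall n \near \oo, `|f n| <= K) -> weakly_cvg f F ->
  w n @[n --> \oo] --> v -> (f n (w n) : R) @[n --> \oo] --> (F v : R).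
Proof.
move=> K0 fK fF wv; apply/cvgrPdist_lt => e e0.
have e2 : 0 < e / 2 by rewrite divr_gt0.
have K1 : 0 < K + 1 by rewrite ltr_pwDr.
have /cvgrPdist_lt/(_ _ e2) fv := fF (bidual v).
have /cvgrPdist_lt/(_ _ (divr_gt0 e2 K1)) wvn := wv.
near=> n.
have -> : (F v : R) - f n (w n) = (F v - f n v) + f n (v - w n).
  by rewrite dualBr addrA subrK.
apply: le_lt_trans (ler_normD _ _) _; rewrite [e]splitr ltr_leD//.
  by near: n; exact: fv.
apply: le_trans (ler_dual_norm _ _) _.
apply: le_trans (_ : (K + 1) * `|v - w n| <= _).
  rewrite ler_wpM2r//; apply: le_trans (_ : K <= _); last by rewrite lerDl.
  by near: n; exact: fK.
by rewrite mulrC -ler_pdivlMr//; apply: ltW; near: n; exact: wvn.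
Unshelve. all: by end_near. Qed.

(** Monotonicity against [x + (w + e)] bounds [ys ((1 - t) w + e)] above, and monotonicity against
    [x] bounds [ys w] below; together they bound [ys e] for all small [e]. *)
Lemma monotone_directionally_bounded (R : realType) (X : normedModType R)
    (A : X -> set (dual X)) (x v : X) (s K : R) :
  monotone_operator A -> domain A x -> 0 < s -> 0 <= K ->
  (forall u, `|u - v| <= s -> exists2 us, A (x + u) us & `|us| <= K) ->
  exists2 C : R, 0 <= C & forall w t ys, `|w - v| <= s / 2 -> 0 < t <= 1 ->
    A (x + t *: w) ys -> `|ys| <= C.
Proof.
move=> mA [xs Ax] s0 K0 Av; have s2 : 0 < s / 2 by rewrite divr_gt0.
exists ((K * (`|v| + s + s) + `|xs| * (`|v| + s)) / (s / 2)).
  by rewrite divr_ge0 ?(ltW s2)// addr_ge0// mulr_ge0// !addr_ge0// ltW.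
move=> w t ys wv /andP[t0 t1] Ay.
have nw : `|w| <= `|v| + s.
  have -> : w = v + (w - v) by rewrite addrC subrK.
  by apply: le_trans (ler_normD _ _) _; rewrite lerD2l (le_trans wv)//; lra.
apply: dual_norm_le_ball => // e es.
have [us Au usK] : exists2 us, A (x + (w + e)) us & `|us| <= K.
  apply: Av; rewrite addrAC [s]splitr.
  by apply: le_trans (ler_normD _ _) _; rewrite lerD.
have := mA _ _ _ _ Au Ay; rewrite dualBl subr_ge0.
have -> : x + (w + e) - (x + t *: w) = (1 - t) *: w + e.
  by rewrite opprD addrACA subrr add0r scalerBl scale1r addrAC.
rewrite (dualDr ys) dualZr => h1.
have h2 : us ((1 - t) *: w + e) <= K * (`|v| + s + s).
  apply: le_trans (ler_pairing _ _) _; rewrite ler_pM//.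
  apply: le_trans (ler_normD _ _) _; rewrite lerD//; last by lra.
  rewrite normrZ ger0_norm ?subr_ge0//.
  by apply: le_trans nw; rewrite ler_piMl//; lra.
have h3 : xs w <= ys w :> R.
  have := mA _ _ _ _ Ay Ax; rewrite addrAC subrr add0r dualZr dualBl.
  by rewrite pmulr_rge0// subr_ge0.
have h4 : - (`|xs| * (`|v| + s)) <= (1 - t) * xs w.
  have : `|(1 - t) * xs w| <= 1 * (`|xs| * (`|v| + s)).
    rewrite normrM ler_pM//; first by rewrite ger0_norm ?subr_ge0//; lra.
    by apply: le_trans (ler_dual_norm _ _) _; rewrite ler_wpM2l//; exact: dual_norm_ge0.
  by rewrite mul1r ler_norml => /andP[].
have h5 : (1 - t) * xs w <= (1 - t) * ys w by rewrite ler_wpM2l// subr_ge0.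
move: h1 h2 h3 h4 h5; set a := (1 - t) * ys w; set b := (1 - t) * xs w.
set c := us _; set d := ys e.
move=> h1 h2 _ h4 h5; lra.
Qed.

(** * Weak directional limits of the selection *)

Theorem lemma4p1 (R : realType) (X : completeNormedModType R)
    (A : X -> set (dual X)) (D : set X) (At : X -> dual X) :
  reflexive_space X ->
  maximal_monotone A ->
  (domain A)° !=set0 ->
  dense_in D (domain A) ->
  selection A At ->
  forall x v : X,
    domain A x ->
    ([set y - x | y in domain A])° v ->
    wLimsup D At x v !=set0 /\ wLimsup D At x v `<=` face A x v.
Proof.
move=> reflX maxA _ [DA AD] selA x v Ax /nbhs_normP[r /= r0 rA].
have mA := maxA.1.
have Av u : `|u - v| < r -> domain A (x + u).
  move=> uv; rewrite distrC in uv; have [y Ay <-] := rA u uv.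
  by rewrite addrC subrK.
have [s0 [K [s00 K0 AK]]] : exists s K : R, [/\ 0 < s, 0 <= K &
    forall y ys, `|y - (x + v)| <= s -> A y ys -> `|ys| <= K].
  apply: (monotone_locally_bounded mA r0) => u uv.
  have -> : u = x + (u - x) by rewrite addrC subrK.
  by apply: Av; rewrite -addrA -opprD.
(* Halving [r] keeps the closed ball of radius [s] inside the open ball of radius [r]. *)
pose s := Num.min s0 (r / 2).
have sp : 0 < s by rewrite lt_min s00 divr_gt0.
have AvK u : `|u - v| <= s -> exists2 us, A (x + u) us & `|us| <= K.
  rewrite le_min => /andP[us ur]; have [|us' Au] := Av u; first by lra.
  exists us' => //; apply: AK Au.
  by rewrite opprD addrACA subrr add0r.
have [C C0 AC] := monotone_directionally_bounded mA Ax sp K0 AvK.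
have s2 : 0 < s / 2 by rewrite divr_gt0.
split; last first.
  move=> ys [w [t [wv [t0 t_0] Dw wk]]].
  have bd : \forall n \near \oo, `|At (x + t n *: w n)| <= C.
    near=> n; apply: (AC (w n) (t n)).
    - by rewrite distrC; near: n; move/cvgrPdist_le: wv; exact.
    - rewrite t0/= -[t n]gtr0_norm// -normrN -sub0r.
      by near: n; move/cvgrPdist_le: t_0; exact.
    - by apply: selA; apply: DA.
  have yx : x + t n *: w n @[n --> \oo] --> x.
    rewrite -[X in _ --> X]addr0 -(scale0r v).
    by apply: cvgD; [exact: cvg_cst|exact: cvgZ].
  have Ays : A x ys.
    apply: maximal_monotoneP => // a as_ Aa; rewrite dualBl subr_ge0.
    have c1 : (At (x + t n *: w n) (x + t n *: w n - a) : R) @[n --> \oo]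
        --> (ys (x - a) : R).
      by apply: weakly_cvg_pairing C0 bd wk _; apply: cvgB => //; exact: cvg_cst.
    have c2 : (as_ (x + t n *: w n - a) : R) @[n --> \oo] --> (as_ (x - a) : R).
      apply: (@continuous_cvg _ _ _ _ _ _ as_); first exact: dual_continuous.
      by apply: cvgB => //; exact: cvg_cst.
    apply: (ler_cvg_to c2 c1); near=> n.
    by rewrite -subr_ge0 -dualBl; apply: mA => //; apply: selA; apply: DA.
  split=> //; apply/eqP; rewrite eq_le; apply/andP; split.
    by apply: ereal_sup_ubound; exists ys.
  apply: ge_ereal_sup => _ [xs Axs <-]; rewrite lee_fin.
  have c1 : (At (x + t n *: w n) (w n) : R) @[n --> \oo] --> (ys v : R).
    exact: weakly_cvg_pairing C0 bd wk wv.
  have c2 : (xs (w n) : R) @[n --> \oo] --> (xs v : R).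
    by apply: (@continuous_cvg _ _ _ _ _ _ xs) => //; exact: dual_continuous.
  apply: (ler_cvg_to c2 c1); near=> n.
  (* The positive factor [t n] cancels before the limit is taken. *)
  have := mA _ _ _ _ (selA _ (DA _ (Dw n))) Axs.
  by rewrite addrAC subrr add0r dualZr dualBl pmulr_rge0// subr_ge0.
pose t n : R := n.+1%:R^-1.
have t0 n : 0 < t n by rewrite invr_gt0.
have t1 n : t n <= 1 by rewrite invf_le1// ler1n.
have /choice[w wP] n : exists w, [/\ D (x + t n *: w), `|w - v| <= s / 2 &
    `|w - v| <= t n].
  have [xs Axs] := Ax.
  have tn : 0 < t n <= 1 by rewrite t0 t1.
  have /AD zD := maximal_monotone_segment maxA Axs sp K0 AvK tn.
  (* Passing from [d - x] to [w] divides by [t n], hence the factor. The bound [s / 2] keeps [w]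
     where [AC] applies, and [t n] forces [w] to tend to [v]. *)
  pose e := t n * Num.min (s / 2) (t n).
  have e0 : 0 < e by rewrite mulr_gt0// lt_min s2 t0.
  have [d [Dd]] := zD _ (nbhsx_ballx _ _ e0).
  rewrite -ball_normE /= distrC => dz.
  exists ((t n)^-1 *: (d - x)).
  have -> : (t n)^-1 *: (d - x) - v = (t n)^-1 *: (d - (x + t n *: v)).
    by rewrite opprD addrA [RHS]scalerBr scalerA mulVf ?scale1r// gt_eqF.
  have : `|(t n)^-1 *: (d - (x + t n *: v))| <= Num.min (s / 2) (t n).
    by rewrite normrZ gtr0_norm ?invr_gt0// ler_pdivrMl// ltW.
  rewrite le_min => /andP[h1 h2]; split=> //.
  by rewrite scalerA divff ?gt_eqF// scale1r addrC subrK.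
have bd n : `|At (x + t n *: w n)| <= C.
  have [Dn wn _] := wP n; apply: (AC (w n) (t n)) => //; first by rewrite t0 t1.
  by apply: selA; exact: DA.
have [k [F [kn kF]]] := bounded_dual_weakly_cvg reflX bd.
(* Since [n <= k n], convergence passes to the extracted sequences even if [k] is not increasing. *)
have tk n : t (k n) <= t n by rewrite lef_pV2 ?posrE// ler_nat ltnS.
exists F, (fun n => w (k n)), (fun n => t (k n)); split=> //.
- apply/cvgrPdist_lt => e e0; near=> n.
  rewrite distrC; have [_ _ /le_lt_trans->//] := wP (k n).
  apply: le_lt_trans (tk n) _.
  by near: n; exact: near_infty_natSinv_lt (PosNum e0).
- split=> //; apply/cvgrPdist_lt => e e0; near=> n.
  rewrite sub0r normrN gtr0_norm//; apply: le_lt_trans (tk n) _.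
  by near: n; exact: near_infty_natSinv_lt (PosNum e0).
- by move=> n; have [] := wP (k n).
Unshelve. all: by end_near. Qed.
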